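(* Let $N\ge 0$ be an integer. Then the generating function of the hypergeometric Euler numbers $E_{N,n}$ has the continued fraction expansion $$\sum_{n=0}^\infty E_{N,n}\frac{x^n}{n!}=1-\cfrac{x^2}{(2N+1)(2N+2)+x^2-\cfrac{(2N+1)(2N+2)x^2}{(2N+3)(2N+4)+x^2-\cfrac{(2N+3)(2N+4)x^2}{(2N+5)(2N+6)+x^2-\ddots}}}\,,$$ i.e. the continued fraction $a_0+\cfrac{b_1}{a_1+\cfrac{b_2}{a_2+\ddots}}$ with $a_0=1$, $b_1=-x^2$, $a_n=(2N+2n-1)(2N+2n)+x^2$ for $n\ge 1$, and $b_n=-(2N+2n-3)(2N+2n-2)x^2$ for $n\ge 2$.
   Context: The hypergeometric Euler numbers $E_{N,n}$ are defined by $$\frac{1}{{}_1F_2(1;N+1,(2N+1)/2;x^2/4)}=\sum_{n=0}^\infty E_{N,n}\frac{x^n}{n!},$$ where ${}_1F_2(a;b,c;z)=\sum_{n=0}^\infty\frac{(a)^{(n)}}{(b)^{(n)}(c)^{(n)}}\frac{z^n}{n!}$ and $(y)^{(n)}=y(y+1)\cdots(y+n-1)$ for $n\ge 1$, $(y)^{(0)}=1$. Convention on continued fractions: for polynomials $a_n$ ($n\ge 0$), $b_n$ ($n\ge 1$) in $x$, the convergents $P_n/Q_n$ of $a_0+\cfrac{b_1}{a_1+\cfrac{b_2}{a_2+\ddots}}$ are defined by $P_{-1}=1$, $Q_{-1}=0$, $P_0=a_0$, $Q_0=1$, $P_n=a_nP_{n-1}+b_nP_{n-2}$, $Q_n=a_nQ_{n-1}+b_nQ_{n-2}$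 ($n\ge 1$). A formal power series $f(x)$ has this continued fraction expansion (written as an equality) if for every $n\ge 0$ the power series expansion at $x=0$ of $P_n(x)/Q_n(x)$ agrees with $f(x)$ up to and including the term in $x^n$, i.e. $P_n/Q_n\equiv f\pmod{x^{n+1}}$; in particular $f=\lim_{n\to\infty}P_n/Q_n$ as formal power series. *)

(* Defs.v *)
From HB Require Import structures.
From mathcomp Require Import all_boot all_order all_algebra.
Set Implicit Arguments.
Unset Strict Implicit.
Unset Printing Implicit Defensive.
Import GRing.Theory Num.Theory.
Local Open Scope ring_scope.

(* A formal power series is its coefficient sequence; equality of series is
   pointwise equality [=1]. *)
Definition fps (R : Type) : Type := nat -> R.

Section FormalPowerSeries.
Variable F : fieldType.
Implicit Types (f g : fps F) (p q : {poly F}).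

Definition fps_of_poly p : fps F := fun n => p`_n.

Definition fps_mul f g : fps F := fun n => \sum_(i < n.+1) f i * g (n - i)%N.

(* The first n coefficients of the reciprocal 1/f, by solving g * f = 1
   degree by degree. *)
Fixpoint fps_inv_seq f (n : nat) : seq F :=
  if n is m.+1 then
    let s := fps_inv_seq f m in
    rcons s ((f 0)^-1 * ((m == 0)%:R - \sum_(i < m) s`_i * f (m - i)%N))
  else [::].

(* Meaningful when f 0 != 0; see fps_mulVf. *)
Definition fps_inv f : fps F := fun n => (fps_inv_seq f n.+1)`_n.

(* The composite f(p(x)); the truncation of the sum at k = n is exact when p
   has no constant term, the only case in which the composite makes sense for
   an arbitrary f. *)
Definition fps_comp f p : fps F := fun n => \sum_(k < n.+1) f k * (p ^+ k)`_n.

Definition egf (u : nat -> F) : fps F := fun n => u n / n`!%:R.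

(* g is the power series expansion at 0 of the rational function p / q.  Common
   powers of x in p and q are allowed; g is unique, see expansion_inj. *)
Definition is_expansion p q g : Prop :=
  q != 0 /\ fps_mul (fps_of_poly q) g =1 fps_of_poly p.

(* The pair (y_(n-1), y_n), where y_(-1) = u, y_0 = v and
   y_n = a_n y_(n-1) + b_n y_(n-2). *)
Fixpoint cfrac_rec (a b : nat -> {poly F}) (u v : {poly F}) (n : nat) :
    {poly F} * {poly F} :=
  if n is m.+1 then
    let y := cfrac_rec a b u v m in (y.2, a n * y.2 + b n * y.1)
  else (u, v).

(* The value b 0 is never used. *)
Definition cfrac_num (a b : nat -> {poly F}) (n : nat) : {poly F} :=
  (cfrac_rec a b 1 (a 0) n).2.
Definition cfrac_den (a b : nat -> {poly F}) (n : nat) : {poly F} :=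
  (cfrac_rec a b 0 1 n).2.

Definition has_cfrac_expansion f (a b : nat -> {poly F}) : Prop :=
  forall n : nat, exists g : fps F,
    is_expansion (cfrac_num a b n) (cfrac_den a b n) g /\
    (forall k : nat, (k <= n)%N -> g k = f k).

Definition rising (y : F) (n : nat) : F := \prod_(i < n) (y + i%:R).

Definition hyp1F2 (a b c : F) : fps F :=
  fun n => rising a n / (rising b n * rising c n) / n`!%:R.

Lemma size_fps_inv_seq f n : size (fps_inv_seq f n) = n.
Proof. by elim: n => //= n IHn; rewrite size_rcons IHn. Qed.

Lemma nth_fps_inv_seq f n i : (i < n)%N -> (fps_inv_seq f n)`_i = fps_inv f i.
Proof.
elim: n => //= n IHn; rewrite ltnS leq_eqVlt => /orP[/eqP -> //|lt_in].
by rewrite nth_rcons size_fps_inv_seq lt_in IHn.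
Qed.

Lemma fps_invE f n :
  fps_inv f n = (f 0)^-1 * ((n == 0)%:R - \sum_(i < n) fps_inv f i * f (n - i)%N).
Proof.
rewrite {1}/fps_inv /= nth_rcons size_fps_inv_seq ltnn eqxx.
by under eq_bigr => i _ do rewrite nth_fps_inv_seq //.
Qed.

Lemma fps_mulVf f : f 0 != 0 -> fps_mul (fps_inv f) f =1 fps_of_poly 1.
Proof.
move=> f0 n; rewrite /fps_mul big_ord_recr /= subnn (fps_invE f n).
by rewrite mulrAC mulVf // mul1r addrC subrK /fps_of_poly coef1.
Qed.

Lemma expansion_inj p q g h : is_expansion p q g -> is_expansion p q h -> g =1 h.
Proof.
move=> [q0 Eg] [_ Eh].
have exq : exists i, q`_i != 0.
  by exists (size q).-1; rewrite -lead_coefE lead_coef_eq0.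
case: (ex_minnP exq) => m qm minm n.
elim/ltn_ind: n => n IHn.
have := etrans (Eg (m + n)%N) (esym (Eh (m + n)%N)).
have lt_m : (m < (m + n).+1)%N by rewrite ltnS leq_addr.
rewrite /fps_mul (bigD1 (Ordinal lt_m)) //= [RHS](bigD1 (Ordinal lt_m)) //=.
rewrite addKn /fps_of_poly => E.
apply: (mulfI qm); move: E.
set A := (X in _ + X = _); set B := (X in _ = _ + X).
suff -> : A = B by move/addIr.
apply: eq_bigr => i; rewrite -val_eqE /= => ne_im.
case: (ltngtP i m) ne_im => // [lt_im | lt_mi] _.
  have [->|/minm] := eqVneq q`_i 0; first by rewrite !mul0r.
  by rewrite leqNgt lt_im.
rewrite IHn //; have := ltn_ord i; rewrite ltnS => le_i.
by rewrite ltn_subLR // ltn_add2r.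
Qed.

End FormalPowerSeries.

(* 1F2(1; N+1, (2N+1)/2; x^2/4) as a power series in x. *)
Definition euler_hyp (N : nat) : fps rat :=
  fps_comp (hyp1F2 1 (N.+1)%:R ((2 * N + 1)%:R / 2)) (4^-1 *: 'X^2).

Definition hyper_euler (N n : nat) : rat :=
  n`!%:R * fps_inv (euler_hyp N) n.

Lemma euler_hyp0 N : euler_hyp N 0 = 1.
Proof.
rewrite /euler_hyp /fps_comp big_ord_recl big_ord0 /hyp1F2 /rising !big_ord0.
by rewrite expr0 coef1 !(mulr1, divr1, addr0) ?invr1 ?mulr1.
Qed.

Lemma egf_hyper_euler N :
  fps_mul (egf (hyper_euler N)) (euler_hyp N) =1 fps_of_poly 1.
Proof.
move=> n; rewrite -(@fps_mulVf _ (euler_hyp N)) ?euler_hyp0 ?oner_eq0 //.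
apply: eq_bigr => i _; congr (_ * _); rewrite /egf /hyper_euler mulrAC divff ?mul1r //.
by rewrite pnatr_eq0 -lt0n fact_gt0.
Qed.

(* Main.v *)
Require Import Defs.
From mathcomp Require Import all_boot all_order all_algebra.
From mathcomp Require Import zify ring lra.
Import GRing.Theory Num.Theory.
Local Open Scope ring_scope.

(** Put [c_i = (2N+2i-1)(2N+2i)] and [t = x^2].  The coefficient of [t^k] in
    the hypergeometric series is [1 / (c_1 ... c_k)].  By induction
    [P_n = c_1 ... c_n] and [Q_n = c_n Q_(n-1) + t^n], so that [Q_n / P_n] is
    the truncation of that series after [t^n], and [P_n / Q_n] agrees with its
    reciprocal up to and including [x^n]. *)

Section EulerContinuedFraction.
Variables (F : fieldType) (t : {poly F}) (c : nat -> F) (a b : nat -> {poly F}).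
Hypotheses (a0 : a 0 = 1) (aS : forall n, a n.+1 = (c n)%:P + t).
Hypotheses (b1 : b 1 = - t) (bSS : forall n, b n.+2 = - ((c n)%:P * t)).

(** Here [c] is indexed from 0, so [c n] is the constant c_(n+1) of the outline. Once P_(n+1) =
    [c n] P_n is known, the two terms in [t] of the recurrence for P_(n+2) cancel. *)
Lemma cfrac_num_prod n : cfrac_num a b n = (\prod_(i < n) c i)%:P.
Proof.
(* The recurrence has order two, so the induction carries two consecutive numerators. Its base case
   absorbs [b 1], which does not follow the pattern [bSS]. *)
suff: cfrac_rec a b 1 (a 0) n.+1
    = ((\prod_(i < n) c i)%:P, (\prod_(i < n.+1) c i)%:P) by case.
elim: n => [|n IHn].
  by rewrite /= big_ord1 big_ord0 a0 aS b1 !mulr1 addrK.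
have -> : cfrac_rec a b 1 (a 0) n.+2 = let y := cfrac_rec a b 1 (a 0) n.+1 in
    (y.2, a n.+2 * y.2 + b n.+2 * y.1) by [].
rewrite IHn /= aS bSS.
rewrite 2![in RHS]big_ord_recr big_ord_recr /= !polyCM; congr pair; ring.
Qed.

(** The recurrence regroups as Q_(n+2) - [c n.+1] Q_(n+1) = [t] (Q_(n+1) - [c n] Q_n), so this
    difference is multiplied by [t] at each step. *)
Lemma cfrac_denS n :
  cfrac_den a b n.+1 = (c n)%:P * cfrac_den a b n + t ^+ n.+1.
Proof.
elim: n => [|n IHn]; first by rewrite /cfrac_den /= aS; ring.
have -> : cfrac_den a b n.+2
    = a n.+2 * cfrac_den a b n.+1 + b n.+2 * cfrac_den a b n by [].
(* The power [t ^+ n.+1] is rewritten as Q_(n+1) - [c n] Q_n, by [IHn] read backwards. *)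
rewrite aS bSS (exprS t n.+1) -[X in t * X](addKr ((c n)%:P * cfrac_den a b n)).
by rewrite -IHn; ring.
Qed.

Lemma cfrac_den_sum n : (forall i, c i != 0) ->
  cfrac_den a b n
  = (\prod_(i < n) c i) *: \sum_(k < n.+1) (\prod_(i < k) c i)^-1 *: t ^+ k.
Proof.
move=> c0; have p0 m : \prod_(i < m) c i != 0 by apply/prodf_neq0.
elim: n => [|n IHn].
  by rewrite big_ord1 !big_ord0 invr1 !scale1r expr0.
rewrite cfrac_denS IHn [in RHS](big_ord_recr n.+1) /= scalerDr scalerA divff ?p0 //.
by rewrite scale1r [\prod_(i < n.+1) _]big_ord_recr mul_polyC scalerA mulrC.
Qed.

End EulerContinuedFraction.

Section FormalPowerSeries.
Variable F : fieldType.
Implicit Types f g : fps F.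

Lemma fps_mulC f g : fps_mul f g =1 fps_mul g f.
Proof.
move=> n; rewrite /fps_mul (reindex_inj rev_ord_inj) /=.
by apply: eq_bigr => i _; rewrite subSS subKn 1?mulrC // -ltnS.
Qed.

(** The coefficient of degree k of a reciprocal involves only coefficients of degree at most k of
    the series. *)
Lemma eq_fps_inv f g n : (forall k, (k <= n)%N -> f k = g k) ->
  forall k, (k <= n)%N -> fps_inv f k = fps_inv g k.
Proof.
move=> fg; elim/ltn_ind => k IHk le_kn; rewrite !fps_invE fg //.
congr (_ * (_ - _)); apply: eq_bigr => i _.
rewrite IHk ?fg //; first exact: leq_trans (leq_subr _ _) le_kn.
exact: leq_trans (ltnW (ltn_ord i)) le_kn.
Qed.

(** The scalar [r] cancels in the quotient. It will be the product P_n, and [p] the truncated series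
    Q_n / P_n. *)
Lemma is_expansion_inv (r : F) (p : {poly F}) : r != 0 -> p`_0 != 0 ->
  is_expansion r%:P (r *: p) (fps_inv (fps_of_poly p)).
Proof.
move=> r0 p0; split.
  by rewrite scale_poly_eq0 negb_or r0; apply: contraNneq p0 => ->; rewrite coef0.
move=> n; have := fps_mulVf p0 n; rewrite fps_mulC => E.
rewrite /fps_of_poly -[r%:P]alg_polyC coefZ.
rewrite -[X in _ * X]E /fps_mul mulr_sumr.
by apply: eq_bigr => i _; rewrite /fps_of_poly coefZ mulrA.
Qed.

End FormalPowerSeries.

Definition euler_c (N i : nat) : rat :=
  (2 * N%:R + 2 * i.+1%:R - 1) * (2 * N%:R + 2 * i.+1%:R).

Lemma euler_c_neq0 N i : euler_c N i != 0.
Proof.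
have N0 : 0 <= N%:R :> rat by rewrite ler0n.
have i0 : 0 <= i%:R :> rat by rewrite ler0n.
by rewrite lt0r_neq0 // mulr_gt0 // -natr1; lra.
Qed.

(** The rising factorial of 1 cancels k!, and 4 (N+1+i) ((2N+1)/2+i) = [euler_c N i] factor by
    factor. *)
Lemma hyp1F2_euler N k :
  hyp1F2 1 N.+1%:R ((2 * N + 1)%:R / 2) k * 4^-1 ^+ k
  = (\prod_(i < k) euler_c N i)^-1 :> rat.
Proof.
have -> : hyp1F2 1 N.+1%:R ((2 * N + 1)%:R / 2) k
    = (rising N.+1%:R k * rising ((2 * N + 1)%:R / 2) k)^-1 :> rat.
  have E : rising 1 k = k`!%:R :> rat.
    rewrite /rising; elim: k => [|k IHk]; first by rewrite big_ord0.
    by rewrite big_ord_recr /= IHk factS natrM nat1r mulrC.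
  by rewrite /hyp1F2 E mulrC mulKf // pnatr_eq0 -lt0n fact_gt0.
rewrite exprVn -invfM; congr _^-1; elim: k => [|k IHk].
  by rewrite /rising !big_ord0 expr0 !mulr1.
rewrite big_ord_recr -IHk /rising !big_ord_recr /= /euler_c.
rewrite -!natr1 natrD natrM exprS; by field.
Qed.

(** The terms with k > j contribute nothing in degree j, since 2k > j. *)
Lemma coef_euler_hyp N n j : (j <= n)%N ->
  (\sum_(k < n.+1) (\prod_(i < k) euler_c N i)^-1 *: 'X^2 ^+ k)`_j
  = euler_hyp N j.
Proof.
move=> le_jn; rewrite /euler_hyp /fps_comp coef_sum.
under [RHS]eq_bigr => k _ do
  rewrite exprZn coefZ mulrA hyp1F2_euler -coefZ.
rewrite [RHS](big_ord_widen n.+1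
  (fun k => ((\prod_(i < k) euler_c N i)^-1 *: 'X^2 ^+ k)`_j)) ?ltnS //.
rewrite [RHS]big_mkcond; apply: eq_bigr => k _.
case: leqP => // lt_jk; rewrite coefZ -exprM coefXn.
by case: eqP => [|_]; [lia | rewrite mulr0].
Qed.

Theorem theorem3 (N : nat) :
  has_cfrac_expansion (egf (hyper_euler N))
    (fun n : nat =>
       if n == 0%N then 1
       else ((2 * N%:R + 2 * n%:R - 1) * (2 * N%:R + 2 * n%:R))%:P + 'X^2)
    (fun n : nat =>
       if (n <= 1)%N then - 'X^2
       else - (((2 * N%:R + 2 * n%:R - 3) * (2 * N%:R + 2 * n%:R - 2))%:P * 'X^2)).
Proof.
move=> n; set a := (X in cfrac_num X); set b := (X in cfrac_num _ X).
have aS m : a m.+1 = (euler_c N m)%:P + 'X^2 by [].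
have bSS m : b m.+2 = - ((euler_c N m)%:P * 'X^2).
  (* At n = m+2, the factors 2N+2n-3 and 2N+2n-2 become 2N+2(m+1)-1 and 2N+2(m+1). *)
  by rewrite /b /= /euler_c; congr (- (_%:P * _)); rewrite -!natr1; ring.
pose T : {poly rat} :=
  \sum_(k < n.+1) (\prod_(i < k) euler_c N i)^-1 *: 'X^2 ^+ k.
exists (fps_inv (fps_of_poly T)); split.
  rewrite (@cfrac_num_prod _ 'X^2 (euler_c N)) //.
  rewrite (@cfrac_den_sum _ 'X^2 (euler_c N)) //; last exact: euler_c_neq0.
  apply: is_expansion_inv; last by rewrite coef_euler_hyp ?euler_hyp0.
  by apply/prodf_neq0 => i _; exact: euler_c_neq0.
move=> k le_kn; rewrite /egf /hyper_euler mulrAC divff ?mul1r; last first.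
  by rewrite pnatr_eq0 -lt0n fact_gt0.
by apply: eq_fps_inv le_kn => j; exact: coef_euler_hyp.
Qed.
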